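(* Let $\mathcal{I}$ be a meager ideal on $\mathbf{N}$ and let $A=(a_{n,i})$ be a regular matrix. Then the set $$\{x\in(0,1]: \Gamma_b^k(x,\mathcal{I},A)\supseteq\Delta_b^k \text{ for all integers } b\ge2,\ k\ge1\}$$ is comeager in $(0,1]$.
   Context: For an integer $b\ge 2$ and $x\in(0,1]$, write $x=\sum_{n\ge 1} d_{b,n}(x)/b^n$ for the unique nonterminating $b$-adic expansion, with digits $d_{b,n}(x)\in\{0,\dots,b-1\}$. Let $S_b^k$ be the set of strings $\bm{s}=s_1\cdots s_k$ of length $k$ over $\{0,\dots,b-1\}$. For $\bm{s}\in S_b^k$ and $n\ge1$ put $\pi_{b,\bm{s},n}(x)=\frac{1}{n}\#\{i\in\{1,\dots,n\}: d_{b,i+j-1}(x)=s_j \text{ for all } j=1,\dots,k\}$, and $\bm{\pi}^k_{b,n}(x)=(\pi_{b,\bm{s},n}(x):\bm{s}\in S_b^k)\in\mathbf{R}^{b^k}$. Let $\Delta_b^k=\{(p_{\bm{s}})_{\bm{s}\in S_b^k}\in\mathbf{R}^{b^k}: \sum_{\bm{s}}p_{\bm{s}}=1,\ p_{\bm{s}}\ge0,\ \sum_{s_0}p_{s_0\bm{s}}=\sum_{s_k}p_{\bm{s}s_k} \text{ for all } \bm{s}\in S_b^{k-1}\}$ (concatenated strings). An ideal on $\mathbf{N}$ is a family $\mathcal{I}\subseteq\mathcal{P}(\mathbf{N})$ closed under finite unions and subsets, containing all finite sets, and $\ne\mathcal{P}(\mathbf{N})$; it is meager if it is a meager subset of $\mathcal{P}(\mathbf{N})$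 with the Cantor-space topology. A regular matrix is an infinite real matrix $A=(a_{n,i})_{n,i\in\mathbf{N}}$ such that for every $d$ and every $\mathbf{R}^d$-valued sequence $\bm{z}=(\bm{z}_i)$ converging to $\bm{\eta}$, the series $A_n\bm{z}:=\sum_i a_{n,i}\bm{z}_i$ exists for all $n$ and $\lim_n A_n\bm{z}=\bm{\eta}$. For a sequence $(x_n)$ in $\mathbf{R}^d$, $\eta$ is an $\mathcal{I}$-cluster point if $\{n: x_n\in U\}\notin\mathcal{I}$ for every open neighborhood $U$ of $\eta$. With $\bm{\pi}^k_b(x)=(\bm{\pi}^k_{b,n}(x):n\ge1)$, $\Gamma_b^k(x,\mathcal{I},A)$ denotes the set of $\mathcal{I}$-cluster points of the sequence $(A_n\bm{\pi}^k_b(x):n\ge1)$. *)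

(* Defs.v *)
From HB Require Import structures.
From mathcomp Require Import all_boot all_order all_algebra.
From mathcomp Require Import all_classical all_reals all_analysis.
Set Implicit Arguments. Unset Strict Implicit. Unset Printing Implicit Defensive.
Import Order.TTheory GRing.Theory Num.Theory.
Import numFieldNormedType.Exports.
Local Open Scope classical_set_scope.
Local Open Scope ring_scope.

Definition nowhere_dense {T : topologicalType} (S : set T) : Prop :=
  interior (closure S) = set0.

Definition meager {T : topologicalType} (M : set T) : Prop :=
  exists N : nat -> set T, (forall n, nowhere_dense (N n)) /\
    M `<=` \bigcup_n N n.

Definition comeager_in {T : topologicalType} (D S : set T) : Prop :=
  @meager (subspace D) (D `\` S).

Definition is_ideal (I : set (set nat)) : Prop :=
  [/\ (forall X Y, I X -> I Y -> I (X `|` Y)),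
      (forall X Y, Y `<=` X -> I X -> I Y),
      (forall X, finite_set X -> I X) &
      ~ (forall X, I X)].

Definition meager_ideal (I : set (set nat)) : Prop :=
  @meager cantor_space [set f : cantor_space | I [set n | f n]].

Section Analysis.
Variable R : realType.

Definition row_psum (A : nat -> nat -> R) (d : nat) (z : nat -> 'rV[R]_d)
  (n N : nat) : 'rV[R]_d := \sum_(i < N) A n i *: z i.

Definition Amul (A : nat -> nat -> R) (d : nat) (z : nat -> 'rV[R]_d)
  (n : nat) : 'rV[R]_d := lim (row_psum A z n @ \oo).

Definition regular_matrix (A : nat -> nat -> R) : Prop :=
  forall (d : nat) (z : nat -> 'rV[R]_d) (eta : 'rV[R]_d),
    z @ \oo --> eta ->
    (forall n, cvg (row_psum A z n @ \oo)) /\ Amul A z @ \oo --> eta.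

(* t_n = ceil(b^n x) - 1 is the integer with t_n/b^n < x <= (t_n+1)/b^n,
   so that d_{b,n}(x) = t_n - b t_{n-1} is the n-th digit (n >= 1) of the
   unique nonterminating b-adic expansion of x in (0,1]. *)
Definition btrunc (b : nat) (x : R) (n : nat) : int :=
  Num.ceil ((b%:R) ^+ n * x) - 1.

Definition digit (b : nat) (x : R) (n : nat) : nat :=
  absz (btrunc b x n - (b%:Z) * btrunc b x n.-1)%R.

Definition str (b k : nat) := (k.-tuple 'I_b).

Definition occ (b k : nat) (x : R) (s : str b k) (n : nat) : nat :=
  \sum_(1 <= i < n.+1) [forall j : 'I_k, digit b x (i + j) == val (tnth s j)].

Definition freq (b k : nat) (x : R) (s : str b k) (n : nat) : R :=
  (occ x s n)%:R / n%:R.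

Definition dimS (b k : nat) : nat := #|{: str b k}|.

Definition pivec (b k : nat) (x : R) (n : nat) : 'rV[R]_(dimS b k) :=
  \row_(j < dimS b k) freq x (enum_val j) n.

Definition coord (b k : nat) (p : 'rV[R]_(dimS b k)) (s : seq 'I_b) : R :=
  match (insub s : option (str b k)) with
  | Some t => p ord0 (enum_rank t)
  | None => 0
  end.

Definition Delta (b k : nat) : set 'rV[R]_(dimS b k) :=
  [set p : 'rV[R]_(dimS b k) | \sum_(j < dimS b k) p ord0 j = 1 /\
           (forall j, 0 <= p ord0 j) /\
           (forall s : (k.-1).-tuple 'I_b,
              \sum_(c : 'I_b) coord p (c :: (s : seq _)) =
              \sum_(c : 'I_b) coord p (rcons s c))].

(* Gamma_b^k(x, I, A): I-cluster points of (A_n pi^k_b(x))_n.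
   Indexing: paper's N={1,2,...} is shifted to nat={0,1,...}, so the
   sequence z_i := pi^k_{b,i+1}(x). *)
Definition Gamma (b k : nat) (x : R) (I : set (set nat)) (A : nat -> nat -> R)
  : set 'rV[R]_(dimS b k) :=
  [set eta | forall U : set 'rV[R]_(dimS b k), open U -> U eta ->
     ~ I [set n | U (Amul A (fun i => pivec b k x i.+1) n)]].

End Analysis.

Arguments Delta R b k _ : clear implicits.
Arguments Gamma {R} b k x I A _.

(* Main.v *)
Require Import Defs.
From HB Require Import structures.
From mathcomp Require Import all_boot all_order all_algebra.
From mathcomp Require Import all_classical all_reals all_analysis.
From mathcomp Require Import ring lra zify.
Set Implicit Arguments.
Unset Strict Implicit.
Unset Printing Implicit Defensive.
Import Order.TTheory GRing.Theory Num.Theory.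
Import numFieldNormedType.Exports.
Local Open Scope classical_set_scope.
Local Open Scope ring_scope.

(** By the Jalali-Naini--Talagrand argument, a meager ideal comes with
consecutive blocks of integers such that no set containing infinitely many
blocks belongs to the ideal. A balanced probability vector is a convex
combination of frequency vectors of cycles of k-strings, so the frequencies of
periodic words, which are countably many, are dense in Delta. For such a
frequency q, any finite digit prefix can be continued periodically; regularity
of A then makes the transforms converge to q, hence be close to q on some far
block, and since the rows of A are absolutely summable this persists on a whole
b-adic cylinder. So the points whose transforms are close to q on no far block
form a nowhere dense set. *)

(** * Meager ideals *)

Lemma cantor_cylinder_nbhs (f : cantor_space) (m : nat) :
  nbhs f [set g : cantor_space | forall i, (i < m)%N -> g i = f i].
Proof.
elim: m => [|m IH]; first by apply: filterS filterT => g _ i.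
have fm : nbhs f [set g : cantor_space | g m = f m].
  have := @proj_continuous nat (fun _ => bool) m f [set f m].
  by apply; exact: discrete_set1.
apply: filterS (filterI IH fm) => g [gf gm] i.
by rewrite ltnS leq_eqVlt => /predU1P[-> //|]; exact: gf.
Qed.

(** The cylinders at [f] generate a filter. Convergence in the product is tested one coordinate at a
    time, and the cylinder of length [i.+1] fixes coordinate [i]. *)
Lemma cantor_nbhs_cylinder (f : cantor_space) (U : set cantor_space) :
  nbhs f U ->
  exists m, [set g : cantor_space | forall i, (i < m)%N -> g i = f i] `<=` U.
Proof.
pose cyl (m : nat) :=
  [set g : cantor_space | forall i, (i < m)%N -> g i = f i].
pose F := filter_from [set: nat] cyl.
have FF : Filter F.
  apply: filter_from_filter; first by exists 0%N.
  move=> i j _ _; exists (maxn i j) => // g cg.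
  by split=> l lt_l; apply: cg; rewrite leq_max lt_l ?orbT.
have Ff : F --> f.
  apply/cvg_sup => i V; rewrite nbhsE /= => -[W [[A _ <-] /= Af] WV].
  by exists i.+1 => // g cg; apply: WV => /=; rewrite /proj cg.
by move=> /Ff [m _ mU]; exists m.
Qed.

(** The cylinder of [u] of length [m] has a point outside [closure N], and a whole cylinder around
    that point misses [N]. *)
Lemma nowhere_dense_extend (N : set cantor_space) (u : nat -> bool) (m : nat) :
  nowhere_dense N ->
  exists n (g : nat -> bool), [/\ (m <= n)%N,
    forall i, (i < m)%N -> g i = u i &
    forall f, (forall i, (i < n)%N -> f i = g i) -> ~ N f].
Proof.
move=> Nnd.
have : ~ nbhs (u : cantor_space) (closure N).
  by move=> /= uN; have : (closure N)° u by []; rewrite Nnd.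
move=> notN.
have [f fu Nf] : exists2 f : cantor_space,
    (forall i, (i < m)%N -> f i = u i) & ~ closure N f.
  apply: contrapT => nof; apply: notN.
  apply: filterS (cantor_cylinder_nbhs u m) => g gu.
  by apply: contrapT => Ng; apply: nof; exists g.
have : nbhs f (~` N).
  move: Nf => /existsNP[B] /not_implyP[fB NB].
  by apply: filterS fB => g Bg Ng; apply: NB; exists g.
move=> /cantor_nbhs_cylinder[n nN].
exists (maxn m n), f; split=> //; first exact: leq_maxl.
move=> g gf; apply: nN => i lt_in; apply: gf.
by rewrite leq_max lt_in orbT.
Qed.

(** One pattern serves all prefixes in [L]: they are treated in turn, and each only lengthens the
    pattern, which preserves what was gained for the others. *)
Lemma nowhere_dense_pattern (N : nat -> set cantor_space)
    (L : seq (nat * seq bool)) (m : nat) :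
  (forall j, nowhere_dense (N j)) ->
  exists n (g : nat -> bool), (m <= n)%N /\
    forall j u, (j, u) \in L -> forall f : nat -> bool,
      (forall i, (i < m)%N -> f i = nth false u i) ->
      (forall i, (m <= i < n)%N -> f i = g i) -> ~ N j f.
Proof.
move=> Nnd; elim: L => [|[j u] L [n [g [mn gL]]]].
  by exists m, (fun=> false).
pose h i := if (i < m)%N then nth false u i else g i.
have [n' [g' [nn' g'h g'N]]] := nowhere_dense_extend h n (Nnd j).
exists n', g'; split=> [|j' u']; first exact: leq_trans nn'.
rewrite in_cons => /predU1P[[-> ->] f fu fg|jL f fu fg].
  apply: g'N => i lt_i; case: (ltnP i m) => im; last by rewrite fg// im.
  by rewrite fu// g'h ?(leq_trans im)// /h im.
apply: gL jL _ fu _ => i /andP[mi ni]; rewrite fg ?mi ?(leq_trans ni)//.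
by rewrite g'h// /h ltnNge mi.
Qed.

Lemma meager_pattern (N : nat -> set cantor_space) (k m : nat) :
  (forall j, nowhere_dense (N j)) ->
  exists ng : nat * (nat -> bool), (m < ng.1)%N /\
    forall f : nat -> bool, (forall i, (m <= i < ng.1)%N -> f i = ng.2 i) ->
      forall j, (j <= k)%N -> ~ N j f.
Proof.
move=> Nnd.
(* With every prefix of length [m] listed, the condition on the prefix disappears. *)
pose L := [seq (j, u) | j <- iota 0 k.+1, u <- map val (enum {: m.-tuple bool})].
have [n [g [mn gL]]] := nowhere_dense_pattern L m Nnd.
exists (n.+1, g); split=> // f fg j jk.
apply: (gL j (mkseq f m) _ f) => // [|i im|i /andP[mi ni]]; last 2 first.
- by rewrite nth_mkseq.
- by rewrite fg//= mi ltnW.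
apply/allpairsP; exists (j, mkseq f m); split=> //.
  by rewrite mem_iota /= add0n ltnS.
have szf : size (mkseq f m) == m by rewrite size_mkseq.
by apply/mapP; exists (Tuple szf); rewrite ?mem_enum.
Qed.

(** Block [i] carries a pattern [t i] that keeps any set following it out of [N 0], ..., [N i]. A
    member of the ideal containing infinitely many blocks would have a subset that follows
    infinitely many patterns, hence lies in no [N j]. *)
Lemma meager_ideal_intervals (I : set (set nat)) :
  is_ideal I -> meager_ideal I ->
  exists2 nn : nat -> nat, forall i, (i <= nn i)%N & forall X : set nat,
    (forall m, exists2 i, (m <= i)%N &
       forall n, (nn i <= n < nn i.+1)%N -> X n) -> ~ I X.
Proof.
move=> [_ Isub _ _] [N [Nnd IN]].
have /choice[F FP] : forall p : nat * nat, exists ng : nat * (nat -> bool),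
  (p.2 < ng.1)%N /\
    forall f : nat -> bool, (forall i, (p.2 <= i < ng.1)%N -> f i = ng.2 i) ->
      forall j, (j <= p.1)%N -> ~ N j f.
  by move=> p; exact: meager_pattern.
pose nn := fix nn i := if i is i'.+1 then (F (i', nn i')).1 else 0%N.
pose t i := (F (i, nn i)).2.
have nn_homo : {homo nn : i j / (i <= j)%N}.
  apply: homo_leq => // [i j k|i]; first exact: leq_trans.
  exact: ltnW (FP (i, nn i)).1.
exists nn => [|X XP IX].
  by elim=> // i IH; apply: leq_ltn_trans IH (FP (i, nn i)).1.
pose S i := forall n, (nn i <= n < nn i.+1)%N -> X n.
pose Y := [set n | exists i, [/\ S i, (nn i <= n < nn i.+1)%N & t i n]].
have YX : Y `<=` X by move=> n [i [Si + _]]; exact: Si.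
pose f n := `[< Y n >].
have fY : [set n | f n] = Y.
  by apply/seteqP; split=> n /=; rewrite /f => /asboolP.
have [j _ Nf] : (\bigcup_n N n) f.
  by apply: IN => /=; rewrite fY; exact: Isub IX.
have [i ji Si] := XP j.
apply: (FP (i, nn i)).2 Nf => //= n ni.
apply/asboolP/idP => [[i' [_ ni' tn]]|tn]; last by exists i.
(* The blocks are disjoint, so [n] lies in only one of them. *)
suff -> : i = i' by [].
move: ni ni' => /andP[n1 n2] /andP[n3 n4].
case: (ltngtP i i') => // /nn_homo le_n.
  by move: (leq_trans n2 (leq_trans le_n n3)); rewrite ltnn.
by move: (leq_trans n4 (leq_trans le_n n1)); rewrite ltnn.
Qed.

(** * Regular matrices have absolutely summable rows *)

Lemma cvg_rowP (R : realType) (d : nat) (z : nat -> 'rV[R]_d) (l : 'rV[R]_d) :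
  z @ \oo --> l <-> forall j, (fun n => z n ord0 j) @ \oo --> l ord0 j.
Proof.
split=> [zl j|zl V [P nP PV]].
  apply: (cvg_comp z (fun M : 'rV[R]_d => M ord0 j) zl).
  exact: coord_continuous.
have nearP : \forall n \near \oo, forall j, P ord0 j (z n ord0 j).
  by apply: filter_forall => j; apply: zl; exact: nP.
by apply: filterS nearP => n zn; apply: PV => i j /=; rewrite ord1; exact: zn.
Qed.

Lemma row_psum_coord (R : realType) (A : nat -> nat -> R) (d : nat)
    (z : nat -> 'rV[R]_d) (n : nat) (j : 'I_d) :
  (fun N => row_psum A z n N ord0 j) = series (fun i => A n i * z i ord0 j).
Proof.
apply/funext => N; rewrite /row_psum summxE seriesEord.
by apply: eq_bigr => i _; rewrite mxE.
Qed.

(* Abel-Dini: if [S n], the [n]-th partial sum of [`|a i|], is unbounded, then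
   [sg (a i) / S i.+1] is a null sequence whose product with [a] is not
   summable. *)
Lemma abs_summable_of_null (R : realType) (a : nat -> R) :
  (forall z : nat -> R, z @ \oo --> (0 : R) ->
     cvgn (series (fun i => a i * z i))) ->
  cvgn (series (fun i => `|a i|)).
Proof.
move=> az; apply: contrapT => dvg.
pose S := series (fun i => `|a i|).
have S_homo : nondecreasing_seq S by apply: nondecreasing_series => *; exact: normr_ge0.
have S0 n : 0 <= S n by rewrite /S /series /=; apply: sumr_ge0.
have S_unb M : exists n, M < S n.
  apply: contrapT => noM; apply: dvg; apply: nondecreasing_is_cvgn => //.
  exists M => _ [n _ <-]; rewrite leNgt; apply/negP => Mn.
  by apply: noM; exists n.
pose z i := Num.sg (a i) / S i.+1.
have z0 : z @ \oo --> (0 : R).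
  apply/cvgrPdist_lt => e e0; have [n Sn] := S_unb e^-1.
  exists n => // i /= ni; rewrite sub0r normrN /z.
  have Si : e^-1 < S i.+1 by apply: lt_le_trans Sn (S_homo _ _ _); exact: leqW.
  have Si0 : 0 < S i.+1 by apply: lt_trans Si; rewrite invr_gt0.
  rewrite normrM normfV (gtr0_norm Si0).
  have sg1 : `|Num.sg (a i)| <= 1 by rewrite normr_sg lern1; case: (_ != _).
  apply: (@le_lt_trans _ _ (S i.+1)^-1).
    by rewrite -[leRHS]mul1r ler_wpM2r// invr_ge0.
  by rewrite -[ltRHS]invrK ltf_pV2// posrE invr_gt0.
have azE : (fun i => a i * z i) = (fun i => `|a i| / S i.+1).
  by apply/funext => i; rewrite /z mulrA [a i * _]mulrC -normrEsg.
have := az z z0; rewrite azE => /cvg_cauchy/cauchy_seriesP.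
have half0 : 0 < 2^-1 :> R by rewrite invr_gt0.
move=> /(_ _ half0)[[P Q] [[m _ mP] [m' _ m'Q]] PQ].
(* Up to [n] the sum [S] more than doubles, and each term is at least [|a i| / S n]; this stretch of
   the series thus exceeds one half, against the Cauchy criterion. *)
have [n Sn] := S_unb (2 * S (maxn m m')).
have mn : (maxn m m' <= n)%N.
  rewrite leqNgt; apply/negP => /ltnW nm.
  by have := S_homo _ _ nm; have := S0 (maxn m m'); lra.
have Sn0 : 0 < S n by have := S0 (maxn m m'); lra.
have PQn : (P `*` Q) (maxn m m', n).
  split; first by apply: mP; exact: leq_maxl.
  by apply: m'Q; exact: leq_trans (leq_maxr _ _) mn.
have /= := PQ _ PQn.
rewrite ltNge => /negP; apply.
apply: le_trans (ler_norm _).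
have -> : 2^-1 = 2^-1 * S n / S n by rewrite mulfK// gt_eqF.
apply: (@le_trans _ _ ((S n - S (maxn m m')) / S n)).
  by rewrite ler_pM2r ?invr_gt0//; lra.
rewrite /S sub_series_geq// big_distrl /= big_nat_cond [leRHS]big_nat_cond.
apply: ler_sum => i /andP[/andP[_ ni] _].
have [->|ai] := eqVneq (a i) 0; first by rewrite normr0 !mul0r.
rewrite ler_wpM2l// lef_pV2 ?posrE//; first exact: S_homo.
rewrite seriesSr; apply: ltr_wpDl; last by rewrite normr_gt0.
exact: S0.
Qed.

Lemma regular_row_summable (R : realType) (A : nat -> nat -> R) (n : nat) :
  regular_matrix A -> cvgn (series (fun i => `|A n i|)).
Proof.
move=> regA; apply: abs_summable_of_null => z z0.
have [|cA _] :=
    regA 1%N (fun i => const_mx (z i)) (const_mx 0).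
  by apply/cvg_rowP => j; rewrite mxE; under eq_cvg do rewrite mxE.
have /cvg_ex[/= l /cvg_rowP/(_ ord0) cl] := cA n.
apply/cvg_ex; exists (l ord0 ord0); move: cl.
rewrite row_psum_coord.
by under [X in series X]eq_fun do rewrite mxE.
Qed.

(** * Counting strings in words *)

(* A word of length [N] is encoded by a function [u : nat -> nat], of which only
   the values below [N] matter; a window starting below [N] may read past the
   end, which costs at most [k] miscounted windows. *)
Definition hit (b k : nat) (s : str b k) (u : nat -> nat) (i : nat) : bool :=
  [forall j : 'I_k, u (i + j)%N == val (tnth s j)].

Definition word_count (b k : nat) (s : str b k) (u : nat -> nat) (N : nat) : nat :=
  (\sum_(i < N) hit s u i)%N.

Lemma eq_hit (b k : nat) (s : str b k) (u v : nat -> nat) (i j : nat) :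
  (forall l, (l < k)%N -> u (i + l)%N = v (j + l)%N) -> hit s u i = hit s v j.
Proof. by move=> uv; apply: eq_forallb => l; rewrite uv. Qed.

Lemma sum_overhang (k N : nat) :
  (\sum_(i < N) (N < i + k) <= minn N k)%N.
Proof.
elim: N => [|N IH]; first by rewrite big_ord0.
rewrite big_ord_recl /= add0n.
rewrite (eq_bigr (fun i : 'I_N => nat_of_bool (N < i + k))%N); last first.
  by move=> i _; rewrite /bump add1n addSn ltnS.
by move: (\sum_(i < N) _)%N IH => S; lia.
Qed.

Lemma word_count_agree (b k : nat) (s : str b k) (u v : nat -> nat) (N : nat) :
  (forall i, (i < N)%N -> u i = v i) ->
  (word_count s u N <= word_count s v N + k)%N.
Proof.
move=> uv; apply: (@leq_trans (\sum_(i < N) (hit s v i + (N < i + k)))%N).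
  apply: leq_sum => i _; case: ltnP => [_|ikN]; first by case: hit; case: hit.
  rewrite addn0 (@eq_hit _ _ _ _ v _ i)// => l lk.
  by rewrite uv// (leq_trans _ ikN)// ltn_add2l.
by rewrite big_split leq_add2l (leq_trans (sum_overhang _ _))// geq_minr.
Qed.

Lemma word_count_addn (b k : nat) (s : str b k) (u : nat -> nat) (M N : nat) :
  word_count s u (M + N) =
  (word_count s u M + word_count s (fun i => u (M + i)) N)%N.
Proof.
rewrite /word_count big_split_ord /=; congr addn; apply: eq_bigr => i _.
by congr nat_of_bool; apply: eq_hit => l _; rewrite addnA.
Qed.

Lemma word_count_le (b k : nat) (s : str b k) (u : nat -> nat) (N : nat) :
  (word_count s u N <= N)%N.
Proof.
rewrite -[leqRHS]card_ord -sum1_card; apply: leq_sum => i _.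
exact: leq_b1.
Qed.

(** * Vectors approximated by word frequencies *)

Section WordApproximation.
Variable R : realType.

(** Complete periods all contribute the same count, as windows overrunning one period read the next.
    The remainder [r] leaves a difference of two numbers between 0 and [r]. *)
Lemma word_count_periodic (b k : nat) (s : str b k) (u : nat -> nat) (L N : nat) :
  (0 < L)%N -> (forall i, u (L + i)%N = u i) ->
  `| (word_count s u N)%:R - N%:R * ((word_count s u L)%:R / L%:R) | <= L%:R :> R.
Proof.
move=> L0 uL; have L0' : 0 < L%:R :> R by rewrite ltr0n.
have [r [q [rL ->]]] : exists r q, (r <= L)%N /\ N = (q * L + r)%N.
  exists (N %% L)%N, (N %/ L)%N; split; last exact: divn_eq.
  by rewrite ltnW// ltn_mod.
have wcq : word_count s u (q * L + r) =
    (q * word_count s u L + word_count s u r)%N.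
  elim: q => [|q IH]; first by rewrite !mul0n.
  rewrite !mulSn -addnA word_count_addn -addnA -IH; congr addn.
  by congr word_count; apply/funext.
have cL : (word_count s u L)%:R / L%:R <= 1 :> R.
  by rewrite ler_pdivrMr// mul1r ler_nat word_count_le.
have c0 : 0 <= (word_count s u L)%:R / L%:R :> R by rewrite divr_ge0.
have cE : (word_count s u L)%:R = (word_count s u L)%:R / L%:R * L%:R :> R.
  by rewrite divfK// gt_eqF.
rewrite wcq !natrD !natrM {1}cE.
set c := _ / _ in cL c0 *.
have r0 : 0 <= r%:R :> R by [].
have rL' : r%:R <= L%:R :> R by rewrite ler_nat.
have wr : (word_count s u r)%:R <= r%:R :> R by rewrite ler_nat word_count_le.
have wr0 : 0 <= (word_count s u r)%:R :> R by [].
have rc : 0 <= r%:R * c <= r%:R.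
  by rewrite mulr_ge0//= -[leRHS]mulr1 ler_wpM2l.
rewrite (_ : _ - _ = (word_count s u r)%:R - r%:R * c); last by ring.
by rewrite ler_norml; lra.
Qed.

(** Words of every large length are required because a convex combination is realised by
    concatenating words of prescribed lengths. *)
Definition approximable (b k : nat) (p : str b k -> R) :=
  forall e : R, 0 < e -> exists N0 : nat, forall N, (N0 <= N)%N ->
    exists2 u : nat -> nat, (forall i, (u i < b)%N) &
      forall s, `| (word_count s u N)%:R - N%:R * p s | <= N%:R * e.

Lemma approximable_periodic (b k : nat) (u : nat -> nat) (L : nat) :
  (0 < L)%N -> (forall i, (u i < b)%N) -> (forall i, u (L + i)%N = u i) ->
  @approximable b k (fun s => (word_count s u L)%:R / L%:R).
Proof.
move=> L0 ub uL e e0; exists (Num.truncn (L%:R / e)).+1 => N LN.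
exists u => // s; apply: le_trans (word_count_periodic _ _ L0 uL) _.
rewrite -ler_pdivrMr//; apply: ltW; apply: lt_le_trans (truncnS_gt _) _.
by rewrite ler_nat.
Qed.

(* The sequence follows a word for [p] during a proportion [t] of the time,
   then a word for [q]; only the [k] windows across the junction are miscounted. *)
Lemma approximable_convex (b k : nat) (p q : str b k -> R) (t : R) :
  0 < t < 1 -> (forall s, 0 <= p s <= 1) -> (forall s, 0 <= q s <= 1) ->
  approximable p -> approximable q ->
  approximable (fun s => t * p s + (1 - t) * q s).
Proof.
move=> /andP[t0 t1] p01 q01 Cp Cq e e0.
have e20 : 0 < e / 2 by rewrite divr_gt0.
have [Np pN] := Cp _ e20; have [Nq qN] := Cq _ e20.
have t1' : 0 < 1 - t by rewrite subr_gt0.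
(* The three terms make both pieces long enough ([Np.+1], since rounding [t * N] down may lose 1)
   and let half of the error absorb the [k] junction windows and the rounding. *)
pose B := Np.+1%:R / t + Nq%:R / (1 - t) + k.+1%:R / (e / 2).
have B1 : 0 <= Np.+1%:R / t by rewrite divr_ge0// ltW.
have B2 : 0 <= Nq%:R / (1 - t) by rewrite divr_ge0// ltW.
have B3 : 0 <= k.+1%:R / (e / 2) by rewrite divr_ge0// ltW.
exists (Num.truncn B).+1 => N BN.
have {}BN : B <= N%:R.
  by apply: ltW; apply: lt_le_trans (truncnS_gt _) _; rewrite ler_nat.
have N1 : Np.+1%:R <= t * N%:R.
  by rewrite mulrC -ler_pdivrMr//; apply: le_trans BN; rewrite /B; lra.
have N2 : Nq%:R <= (1 - t) * N%:R.
  by rewrite mulrC -ler_pdivrMr//; apply: le_trans BN; rewrite /B; lra.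
have N3 : k.+1%:R <= N%:R * (e / 2).
  by rewrite -ler_pdivrMr//; apply: le_trans BN; rewrite /B; lra.
have tN0 : 0 <= t * N%:R by rewrite mulr_ge0// ltW.
have /andP[Ml Mr] := truncn_itv tN0.
set M := Num.truncn _ in Ml Mr.
have MN : (M <= N)%N.
  by rewrite -(ler_nat R); apply: le_trans Ml _; rewrite ler_piMl// ltW.
have NpM : (Np <= M)%N.
  by rewrite -ltnS -(ltr_nat R); apply: le_lt_trans Mr; apply: le_trans N1; rewrite ler_nat.
have NMr : (N - M)%:R = N%:R - M%:R :> R by rewrite natrB.
have NqM : (Nq <= N - M)%N.
  by rewrite -(ler_nat R) NMr; lra.
have [u ub up] := pN _ NpM; have [v vb vq] := qN _ NqM.
pose w i := if (i < M)%N then u i else v (i - M)%N.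
exists w => [i|s]; first by rewrite /w; case: ifP.
have wcE : word_count s w N = (word_count s w M + word_count s v (N - M))%N.
  rewrite -{1}(subnKC MN) word_count_addn; congr (_ + word_count _ _ _)%N.
  by apply/funext => i; rewrite /w ltnNge leq_addr /= addKn.
have wu i : (i < M)%N -> w i = u i by rewrite /w => ->.
have wc1 : (word_count s w M)%:R <= (word_count s u M)%:R + k%:R :> R.
  by rewrite -natrD ler_nat word_count_agree.
have wc2 : (word_count s u M)%:R <= (word_count s w M)%:R + k%:R :> R.
  by rewrite -natrD ler_nat word_count_agree// => i /wu.
rewrite wcE natrD.
have := up s; have := vq s; rewrite NMr.
move: (word_count s w M)%:R (word_count s u M)%:R wc1 wc2 => cw cu wc1 wc2.
move: (word_count s v _)%:R => cv.
have diff : `|(M%:R - t * N%:R) * (p s - q s)| <= 1.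
  rewrite normrM mulr_ile1//.
    by rewrite ler_norml; move: Mr; rewrite -natr1; lra.
  by have := p01 s; have := q01 s; rewrite ler_norml; lra.
move: diff N3; rewrite -natr1 !ler_norml.
(* The four errors: junction, word for [p], word for [q], rounding of [t * N]. *)
have -> : cw + cv - N%:R * (t * p s + (1 - t) * q s) =
  (cw - cu) + (cu - M%:R * p s) + (cv - (N%:R - M%:R) * q s)
   + (M%:R - t * N%:R) * (p s - q s) by ring.
have := ler_nat R M N; rewrite MN.
move: (M%:R * p s) ((N%:R - M%:R) * q s) ((M%:R - t * N%:R) * (p s - q s)).
move=> x y z; lra.
Qed.

End WordApproximation.

(** * Balanced vectors are limits of word frequencies *)

Section BalancedApproximable.
Variables (R : realType) (b k : nat).
Implicit Types (p q : str b k.+1 -> R) (x : nat -> str b k.+1).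

(** Strings of length [k.+1] are the edges of the de Bruijn graph on strings of length [k]; inflow
    equals outflow at each vertex, and a [walk] follows consecutive edges. *)
Definition balanced p := forall s : k.-tuple 'I_b,
  \sum_(c : 'I_b) p [tuple of c :: s] = \sum_(c : 'I_b) p [tuple of rcons s c].

Definition walk x :=
  forall i, exists c, x i.+1 = [tuple of rcons (behead (x i)) c].

Lemma balanced_next p s : (forall s, 0 <= p s) -> balanced p -> 0 < p s ->
  exists c, 0 < p [tuple of rcons (behead s) c].
Proof.
move=> p0 bal_p ps; apply: contrapT => noc.
have : \sum_(c : 'I_b) p [tuple of rcons (behead s) c] <= 0.
  by apply: sumr_le0 => c _; rewrite leNgt; apply/negP => pc; apply: noc; exists c.
have := bal_p (behead_tuple s) => /= <-.
rewrite leNgt (bigD1 (thead s))//= ltr_wpDr//; first exact: sumr_ge0.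
suff -> : [tuple of thead s :: behead s] = s by [].
by rewrite -tuple_eta.
Qed.

(** A positive edge always has a positive successor. Iterating a choice of successor in a finite set
    must revisit a value; the cycle starts there. *)
Lemma balanced_cycle p s0 : (forall s, 0 <= p s) -> balanced p -> 0 < p s0 ->
  exists x L, [/\ (0 < L)%N, walk x, forall i, x (L + i)%N = x i &
    forall i, 0 < p (x i)].
Proof.
move=> p0 bal_p ps0.
have /choice[f fP] : forall s, exists s', 0 < p s ->
    0 < p s' /\ exists c, s' = [tuple of rcons (behead s) c].
  move=> s; case: (pselect (0 < p s)) => [ps|ps]; last by exists s.
  have [c pc] := balanced_next p0 bal_p ps.
  by exists [tuple of rcons (behead s) c]; split=> //; exists c.
have pf n : 0 < p (iter n f s0) by elim: n => //= n /fP[].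
have /trajectP[m mL fmL] := looping_order f s0.
set L := order f s0 in mL fmL.
exists (fun i => iter (m + i) f s0), (L - m)%N; split.
- by rewrite subn_gt0.
- by move=> i; rewrite addnS /=; have [_] := fP _ (pf (m + i)%N).
- by move=> i; rewrite addnA subnKC ?(ltnW mL)// addnC iterD fmL -iterD addnC.
- by move=> i; exact: pf.
Qed.

Lemma walk_nth x c0 i j : walk x -> (j < k.+1)%N ->
  nth c0 (x i) j = thead (x (i + j)%N).
Proof.
move=> wx; elim: j i => [|j IH] i jk.
  by rewrite addn0 {1}(tuple_eta (x i)).
rewrite addnS -addSn -IH; last exact: ltnW.
have [c ->] := wx i.
by rewrite /= nth_rcons size_behead size_tuple /= -ltnS jk nth_behead.
Qed.

(** The first letters of the successive edges spell a word whose window at [i] is [x i]. *)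
Lemma hit_walk x s i : walk x -> hit s (fun i => val (thead (x i))) i = (x i == s).
Proof.
move=> wx; apply/forallP/eqP => [xs|<- j]; last first.
  by rewrite (tnth_nth (thead (x i))) walk_nth.
apply: eq_from_tnth => j; apply/val_inj => /=.
rewrite -(eqP (xs j)) (tnth_nth (thead (x i))) walk_nth//.
Qed.

Definition cycle_freq x (L : nat) (s : str b k.+1) : R :=
  (\sum_(i < L) (x i == s))%:R / L%:R.

Lemma cycle_freq_sum x L : (0 < L)%N -> \sum_s cycle_freq x L s = 1.
Proof.
move=> L0; rewrite -mulr_suml -natr_sum exchange_big /=.
rewrite (eq_bigr (fun=> 1%N)) => [|i _]; last first.
  by rewrite (bigD1 (x i))//= eqxx big1// => s /negbTE; rewrite eq_sym => ->.
by rewrite sum1_card card_ord divff// pnatr_eq0 -lt0n.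
Qed.

Lemma cycle_freq_balanced x L : walk x -> (forall i, x (L + i)%N = x i) ->
  balanced (cycle_freq x L).
Proof.
move=> wx xL s; rewrite -!mulr_suml -!natr_sum; congr (_%:R / _).
rewrite exchange_big [RHS]exchange_big /=.
(* Periodicity allows a shift by one, which matches each edge entering [s] with the next edge,
   leaving [s]. *)
have shift : (\sum_(i < L) \sum_c (x i == [tuple of rcons s c]) =
    \sum_(i < L) \sum_c (x i.+1 == [tuple of rcons s c]))%N.
  case: L xL => [|L] xL; first by rewrite !big_ord0.
  rewrite big_ord_recl [RHS]big_ord_recr /= addnC; congr addn.
  by rewrite -(xL 0%N) addn0.
rewrite [RHS]shift; apply: eq_bigr => i _.
have [c ->] := wx i.
rewrite (bigD1 (thead (x i)))//= [RHS](bigD1 c)//= !big1.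
- rewrite !addn0 -!val_eqE /= eqseq_rcons eqxx andbT.
  by rewrite {1}(tuple_eta (x i)) /= eqseq_cons eqxx.
- by move=> d dc; rewrite -val_eqE /= eqseq_rcons [c == _]eq_sym (negbTE dc) andbF.
- move=> d dx; rewrite -val_eqE /= {1}(tuple_eta (x i)) /= eqseq_cons.
  by rewrite [_ == d]eq_sym (negbTE dx).
Qed.

Lemma cycle_freq_approximable x L : (0 < L)%N -> walk x ->
  (forall i, x (L + i)%N = x i) -> approximable (cycle_freq x L).
Proof.
move=> L0 wx xL; pose u i := val (thead (x i)).
have -> : cycle_freq x L = fun s => (word_count s u L)%:R / L%:R.
  apply/funext => s; congr (_%:R / _); apply: eq_bigr => i _.
  by rewrite hit_walk.
apply: approximable_periodic => // i; first exact: ltn_ord.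
by rewrite /u xL.
Qed.

(* Subtracting the largest possible multiple of a cycle in the support of [p]
   shrinks the support. *)
Lemma balanced_approximable p : (forall s, 0 <= p s) -> \sum_s p s = 1 ->
  balanced p -> approximable p.
Proof.
have [n] := ubnP #|[set s | 0 < p s]%SET|.
elim: n p => // n IH p supp_p p0 p1 bal_p.
have [s0 ps0] : exists s, 0 < p s.
  apply: contrapT => nos; have : \sum_s p s <= 0.
    by apply: sumr_le0 => s _; rewrite leNgt; apply/negP => ps; apply: nos; exists s.
  by rewrite p1 ler10.
have [x [L [L0 wx xL px]]] := balanced_cycle p0 bal_p ps0.
set q := cycle_freq x L.
have q0 s : 0 <= q s by rewrite divr_ge0.
have q1 : \sum_s q s = 1 by exact: cycle_freq_sum.
have Cq : approximable q by exact: cycle_freq_approximable.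
have bal_q : balanced q by exact: cycle_freq_balanced.
have le1 (r : str b k.+1 -> R) s : (forall s, 0 <= r s) -> \sum_s r s = 1 ->
    0 <= r s <= 1.
  by move=> r0 r1; rewrite r0/= -r1 (bigD1 s)//= lerDl sumr_ge0.
have qp s : 0 < q s -> 0 < p s.
  rewrite /q /cycle_freq => qs.
  have : exists i : 'I_L, x i == s.
    apply: contrapT => noi; move: qs; rewrite big1 ?mul0r ?ltxx// => i _.
    by apply/eqP; rewrite eqb0; apply/negP => xi; apply: noi; exists i.
  by move=> [i /eqP <-].
have qs1 : 0 < q (x 0%N).
  rewrite divr_gt0 ?ltr0n//; case: (L) L0 => // L' _.
  by rewrite big_ord_recl /= eqxx.
(* The minimal ratio [t] is the largest multiple with [t * q <= p]; equality at [s1] removes [s1]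
   from the support of the remainder. *)
have [s1 qs1' s1min] := @arg_minP _ _ _ (x 0%N) (fun s => 0 < q s)
  (fun s => p s / q s) qs1.
set t := p s1 / q s1 in s1min.
have t0 : 0 < t by rewrite divr_gt0// qp.
have tq s : t * q s <= p s.
  have := q0 s; rewrite le_eqVlt => /predU1P[<-|qs]; first by rewrite mulr0.
  by rewrite -ler_pdivlMr// s1min.
have t1 : t <= 1.
  by rewrite -[t]mulr1 -{1}q1 mulr_sumr -p1; exact: ler_sum.
(* If [t = 1], then [p - q] is nonnegative with sum 0, so [p] is the cycle frequency itself. *)
have [tE|tlt] : t = 1 \/ t < 1 by move: t1; rewrite le_eqVlt => /predU1P.
  suff -> : p = q by [].
  have pq0 s : 0 <= p s - q s by rewrite subr_ge0 -[q s]mul1r -tE.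
  have : \sum_s (p s - q s) = 0 by rewrite sumrB p1 q1 subrr.
  move=> /eqP; rewrite psumr_eq0 => [/allP pq|s _]; last exact: pq0.
  apply/funext => s; apply/eqP; rewrite -subr_eq0.
  by have := pq s (mem_index_enum s).
have t1' : 0 < 1 - t by rewrite subr_gt0.
pose r s := (p s - t * q s) / (1 - t).
have r0 s : 0 <= r s by rewrite divr_ge0 ?subr_ge0// ltW.
have r1 : \sum_s r s = 1.
  by rewrite -mulr_suml sumrB -mulr_sumr p1 q1 mulr1 divff// gt_eqF.
have bal_r : balanced r.
  move=> s; rewrite -!mulr_suml !sumrB -!mulr_sumr.
  by rewrite (bal_p s) (bal_q s).
have -> : p = fun s => t * q s + (1 - t) * r s.
  by apply/funext => s; rewrite mulrC [(1 - t) * _]mulrC divfK ?gt_eqF//; lra.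
apply: approximable_convex => //; first by rewrite t0.
- by move=> s; exact: le1.
- by move=> s; exact: le1.
apply: IH => //; rewrite -ltnS; apply: leq_trans supp_p.
rewrite ltnS; apply: proper_card; apply/properP; split.
  apply/fintype.subsetP => s; rewrite !inE => rs; rewrite lt_neqAle p0 andbT.
  apply/eqP => ps; move: rs; rewrite /r -ps sub0r mulNr oppr_gt0 ltNge => /negP; apply.
  by apply: divr_ge0; [apply: mulr_ge0 => //; exact: ltW|exact: ltW].
exists s1; rewrite inE ?qp//.
by rewrite /r /t divfK ?gt_eqF// subrr mul0r ltxx.
Qed.

End BalancedApproximable.

(** * Digits and cylinders *)

Section Cylinders.
Variables (R : realType) (b : nat).
Hypothesis b_gt1 : (1 < b)%N.

Lemma btrunc_itv (x : R) n :
  (btrunc b x n)%:~R < b%:R ^+ n * x <= (btrunc b x n)%:~R + 1.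
Proof.
by rewrite -intrD1 /btrunc subrK; exact: Num.Theory.ceil_itv.
Qed.

Lemma btrunc_eq (x : R) n (t : int) :
  t%:~R < b%:R ^+ n * x <= t%:~R + 1 -> btrunc b x n = t.
Proof.
move=> tx; apply: (addIr 1); rewrite /btrunc subrK.
by apply: Num.Theory.ceil_def; rewrite addrK intrD1.
Qed.

Lemma btruncS (x : R) n :
  (b%:Z * btrunc b x n <= btrunc b x n.+1 < b%:Z * (btrunc b x n + 1))%R.
Proof.
have b0 : 0 < b%:R :> R by rewrite ltr0n ltnW.
have /andP[l1 r1] := btrunc_itv x n; have /andP[l2 r2] := btrunc_itv x n.+1.
rewrite exprS -mulrA in l2 r2.
apply/andP; split; rewrite -?ltzD1 -(ltr_int R) ?intrD1 intrM ?intrD1.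
  by apply: lt_le_trans r2; rewrite ltr_pM2l.
by apply: lt_le_trans l2 _; rewrite ler_pM2l.
Qed.

(** The intervals are nested, so the condition at level [N] passes down to every lower level. *)
Lemma btrunc_cylinder (t : nat -> int) (N : nat) (x : R) :
  (forall n, b%:Z * t n <= t n.+1 < b%:Z * (t n + 1)) ->
  (t N)%:~R < b%:R ^+ N * x <= (t N)%:~R + 1 ->
  forall n, (n <= N)%N -> btrunc b x n = t n.
Proof.
move=> tS; have b0 : 0 < b%:R :> R by rewrite ltr0n ltnW.
elim: N => [|N IH] tN n.
  by rewrite leqn0 => /eqP->; exact: btrunc_eq.
rewrite leq_eqVlt => /predU1P[->|]; first exact: btrunc_eq.
rewrite ltnS; apply: IH.
have /andP[l r] := tS N; move: tN; rewrite exprS -mulrA => /andP[tl tr].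
rewrite -(ltr_pM2l b0) -(ler_pM2l b0); apply/andP; split.
  by apply: le_lt_trans tl; rewrite -[b%:R]/(b%:Z%:~R) -intrM ler_int.
apply: le_trans tr _.
by rewrite -[b%:R]/(b%:Z%:~R) -!intrD1 -intrM ler_int lezD1.
Qed.

(** Keep the first [n0] digits of [x0], with [n0] so large that their cylinder lies in the interval
    from [a] to [c], and append [u]. *)
Lemma digit_cylinder (a x0 c : R) (u : nat -> nat) :
  a < x0 < c -> (forall i, (u i < b)%N) ->
  exists n0 (d : nat -> nat), (forall i, d (n0.+1 + i)%N = u i) /\
    forall N, exists a' c' : R, [/\ a' < c',
      forall x : R, a' < x < c' -> a < x < c &
      forall x : R, a' < x < c' -> forall n, (n <= N)%N -> digit b x n = d n].
Proof.
move=> /andP[ax xc] ub; have b0 : 0 < b%:R :> R by rewrite ltr0n ltnW.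
have bX n : 0 < b%:R ^+ n :> R by rewrite exprn_gt0.
pose del := Num.min (x0 - a) (c - x0).
have del0 : 0 < del by rewrite lt_min !subr_gt0 ax.
pose n0 := (Num.truncn del^-1).+1.
have bn0 : 1 < b%:R ^+ n0 * del.
  rewrite -ltr_pdivrMr// div1r; apply: lt_trans (truncnS_gt _) _.
  by rewrite -natrX ltr_nat ltn_expl.
(* [T] and [t] are the truncations [btrunc] of the number to be built; its digits are recovered from
   them as differences. *)
pose T := fix T i := if i is i'.+1 then b%:Z * T i' + (u i')%:Z
                     else btrunc b x0 n0.
pose t n := if (n <= n0)%N then btrunc b x0 n else T (n - n0)%N.
have tT i : t (n0 + i)%N = T i.
  case: i => [|i]; first by rewrite addn0 /t leqnn.
  by rewrite /t addKn leqNgt -addSnnS ltn_addr.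
have tS n : b%:Z * t n <= t n.+1 < b%:Z * (t n + 1).
  case: (ltnP n n0) => nn0; first by rewrite /t nn0 ltnW//; exact: btruncS.
  rewrite -(subnKC nn0) -addnS !tT /= lerDl /= mulrDr mulr1 ltrD2l.
  by rewrite ltz_nat ub.
exists n0, (fun n => absz (t n - b%:Z * t n.-1)%R); split=> [i|N].
  rewrite addSn /= -addnS !tT /=.
  by rewrite [X in absz X]addrC addKr.
pose M := maxn N n0.
exists ((t M)%:~R / b%:R ^+ M), (((t M)%:~R + 1) / b%:R ^+ M).
have cyl (x : R) : (t M)%:~R / b%:R ^+ M < x < ((t M)%:~R + 1) / b%:R ^+ M ->
    forall n, (n <= M)%N -> btrunc b x n = t n.
  move=> /andP[tx xt]; apply: (btrunc_cylinder tS).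
  by rewrite mulrC -ltr_pdivrMr// tx /= -ler_pdivlMr// ltW.
split=> [|x xM|x xM n nN].
- by rewrite ltr_pM2r ?invr_gt0// ltrDl.
- have := btrunc_itv x n0; rewrite (cyl _ xM) ?leq_maxr//.
  rewrite /t leqnn; have := btrunc_itv x0 n0.
  move: bn0; rewrite /del; set B := b%:R ^+ n0 => bn0 /andP[x1 x2] /andP[x3 x4].
  have d1 : 1 < B * (x0 - a).
    by apply: lt_le_trans bn0 _; rewrite ler_pM2l ?bX// ge_min lexx.
  have d2 : 1 < B * (c - x0).
    by apply: lt_le_trans bn0 _; rewrite ler_pM2l ?bX// ge_min lexx orbT.
  by rewrite -(ltr_pM2l (bX n0)) -[x < c](ltr_pM2l (bX n0)) -/B; lra.
- have nM : (n <= M)%N by rewrite leq_max nN.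
  by rewrite /digit !(cyl x)// (leq_trans (leq_pred _)).
Qed.

End Cylinders.

(** This is [pivec] for an abstract digit sequence, so that periodic continuations need not be
    realised by a real number. *)
Definition seq_freq (R : realType) (b k : nat) (d : nat -> nat) (n : nat) :
    'rV[R]_(dimS b k) :=
  \row_(j < dimS b k)
    ((\sum_(1 <= i < n.+1) hit (enum_val j : str b k) d i)%:R / n%:R).

Definition period_freq (R : realType) (b k : nat) (u : nat -> nat) (L : nat) :
    'rV[R]_(dimS b k) :=
  \row_(j < dimS b k) ((word_count (enum_val j : str b k) u L)%:R / L%:R).

Lemma pivecE (R : realType) (b k : nat) (x : R) (n : nat) :
  pivec b k x n = seq_freq R b k (digit b x) n.
Proof. by []. Qed.

Lemma seq_freq_word_count (R : realType) (b k : nat) (d : nat -> nat) (n : nat) j :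
  seq_freq R b k d n ord0 j =
  (word_count (enum_val j : str b k) (fun i => d i.+1) n)%:R / n%:R.
Proof.
by rewrite mxE big_add1 /= big_mkord.
Qed.

Lemma seq_freq_itv (R : realType) (b k : nat) (d : nat -> nat) (n : nat) j :
  0 <= seq_freq R b k d n ord0 j <= 1.
Proof.
rewrite seq_freq_word_count divr_ge0//=; case: n => [|n].
  by rewrite invr0 mulr0.
by rewrite ler_pdivrMr ?ltr0n// mul1r ler_nat word_count_le.
Qed.

Lemma seq_freq_agree (R : realType) (b k : nat) (d d' : nat -> nat) (n : nat) :
  (forall i, (i <= n + k)%N -> d i = d' i) ->
  seq_freq R b k d n = seq_freq R b k d' n.
Proof.
move=> dd'; apply/rowP => j; rewrite !seq_freq_word_count; congr (_%:R / _).
apply: eq_bigr => i _; congr nat_of_bool; apply: eq_hit => l lk.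
apply: dd'; have := ltn_ord i; lia.
Qed.

Lemma seq_freq_cvg (R : realType) (b k : nat) (d u : nat -> nat) (m L : nat) :
  (0 < L)%N -> (forall i, d (m.+1 + i)%N = u i) -> (forall i, u (L + i)%N = u i) ->
  (fun n => seq_freq R b k d n.+1) @ \oo --> period_freq R b k u L.
Proof.
move=> L0 du uL; apply/cvg_rowP => j; apply/cvgrPdist_le => e e0.
(* One [m] for the count in the prefix, one for its share of the limit frequency, and [L] from
   [word_count_periodic]. *)
pose B := (2 * m + L)%:R : R.
near=> n.
rewrite seq_freq_word_count mxE; set s := enum_val j.
have mn : (m <= n.+1)%N by near: n; exists m => // n /=; exact: leqW.
have Bn : B <= e * n.+1%:R.
  rewrite mulrC -ler_pdivrMr//; near: n; exists (Num.truncn (B / e)) => // n /= Bn.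
  by apply: ltW; apply: lt_le_trans (truncnS_gt _) _; rewrite ler_nat ltnS.
rewrite -[X in word_count _ (fun i => d i.+1) X](subnKC mn) word_count_addn natrD.
have -> : (fun i => d (m + i).+1) = u by apply/funext => i; rewrite -addSn.
have := word_count_periodic R s (n.+1 - m) L0 uL.
rewrite natrB//.
have : (word_count s (fun i => d i.+1) m)%:R <= m%:R :> R.
  by rewrite ler_nat word_count_le.
have : 0 <= (word_count s (fun i => d i.+1) m)%:R :> R by [].
move: (word_count s _ m)%:R (word_count s u (_ - _))%:R => x y x0 xm.
have c0 : 0 <= (word_count s u L)%:R / L%:R :> R by rewrite divr_ge0.
have c1 : (word_count s u L)%:R / L%:R <= 1 :> R.
  by rewrite ler_pdivrMr ?ltr0n// mul1r ler_nat word_count_le.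
move: ((word_count s u L)%:R / L%:R) c0 c1 => c c0 c1 yc.
have n0 : 0 < n.+1%:R :> R by [].
rewrite -[c](mulfK (lt0r_neq0 n0)) -mulrBl normrM normfV (gtr0_norm n0).
rewrite ler_pdivrMr//.
apply: le_trans Bn; rewrite /B natrD natrM.
have mc : 0 <= m%:R * c <= m%:R.
  by rewrite mulr_ge0//= ler_piMr.
move: yc; rewrite mulrBl (mulrC c) !ler_norml; lra.
Unshelve. all: by end_near. Qed.

(** * Genericity *)

Section RowTail.
Variables (R : realType) (a : nat -> R).
Hypothesis a_sum : cvgn (series (fun i => `|a i|)).

Lemma cvg_series_mul_bounded (y : nat -> R) : (forall i, `|y i| <= 1) ->
  cvgn (series (fun i => a i * y i)).
Proof.
move=> y1; apply: normed_cvg; apply: series_le_cvg a_sum => i /=; try exact: normr_ge0.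
by rewrite normrM ler_piMr.
Qed.

(** The difference is at most a tail of the sum of [|a i|]. It matters that [N] is uniform in [y]
    and [y']: it will serve a whole cylinder of points. *)
Lemma series_tail_small (e : R) : 0 < e -> exists N : nat,
  forall y y' : nat -> R, (forall i, 0 <= y i <= 1) -> (forall i, 0 <= y' i <= 1) ->
    (forall i, (i < N)%N -> y i = y' i) ->
    `| limn (series (fun i => a i * y i)) - limn (series (fun i => a i * y' i)) | <= e.
Proof.
move=> e0; have /cvg_cauchy/cauchy_seriesP/(_ _ e0) := a_sum.
move=> [[P Q] [[N _ PN] [N' _ QN]] PQ].
exists (maxn N N') => y y' y01 y01' yy'.
have norm1 (v : nat -> R) : (forall i, 0 <= v i <= 1) -> forall i, `|v i| <= 1.
  by move=> v01 i; have /andP[v0 v1] := v01 i; rewrite ger0_norm.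
have cy := cvg_series_mul_bounded (norm1 _ y01).
have cy' := cvg_series_mul_bounded (norm1 _ y01').
set f := series _ in cy *; set g := series _ in cy' *.
have cyy' : `|f n - g n| @[n --> \oo] --> `|limn f - limn g|.
  by apply: cvg_norm; exact: cvgB.
rewrite -(cvg_lim _ cyy')//; apply: limr_le.
  by apply/cvg_ex; eexists; exact: cyy'.
exists (maxn N N') => // n /= Nn.
rewrite /f /g /series /= -sumrB.
rewrite (big_cat_nat (leq0n _) Nn) /= [X in X + _]big_nat_cond.
rewrite [X in X + _]big1 ?add0r => [|i /andP[/andP[_ iN] _]]; last first.
  by rewrite yy'// subrr.
apply: ltW; apply: le_lt_trans (PQ (maxn N N', n) _); last first.
  split; first by apply: PN => /=; exact: leq_maxl.
  by apply: QN => /=; exact: leq_trans (leq_maxr _ _) Nn.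
apply: le_trans (ler_norm_sum _ _ _) (le_trans _ (ler_norm _)).
apply: ler_sum => i _; rewrite -mulrBr normrM ler_piMr//.
by have := y01 i; have := y01' i; rewrite ler_norml; lra.
Qed.

End RowTail.

Section Genericity.
Variables (R : realType) (A : nat -> nat -> R).
Hypothesis A_regular : regular_matrix A.

(** Frequencies of a generic point need not converge, so the existence of the limit in [Amul] comes
    from boundedness and the summable row. *)
Lemma Amul_coord (d : nat) (z : nat -> 'rV[R]_d) n j :
  (forall i j, 0 <= z i ord0 j <= 1) ->
  Amul A z n ord0 j = limn (series (fun i => A n i * z i ord0 j)).
Proof.
move=> z01.
have cz l : cvgn (series (fun i => A n i * z i ord0 l)).
  apply: cvg_series_mul_bounded; first exact: regular_row_summable.
  by move=> i; have /andP[z0 z1] := z01 i l; rewrite ger0_norm.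
have : cvgn (row_psum A z n).
  apply/cvg_ex.
  exists (\row_l limn (series (fun i => A n i * z i ord0 l))).
  by apply/cvg_rowP => l; rewrite row_psum_coord mxE.
move=> /cvg_rowP/(_ j); rewrite row_psum_coord => /(cvg_lim _) <- //.
Qed.

Lemma Amul_tail_small (n : nat) (e : R) : 0 < e -> exists N : nat,
  forall (d : nat) (z z' : nat -> 'rV[R]_d),
    (forall i j, 0 <= z i ord0 j <= 1) -> (forall i j, 0 <= z' i ord0 j <= 1) ->
    (forall i, (i < N)%N -> z i = z' i) ->
    forall j, `|Amul A z n ord0 j - Amul A z' n ord0 j| <= e.
Proof.
move=> e0; have [N NP] := series_tail_small (regular_row_summable (n := n) A_regular) e0.
exists N => d z z' z01 z01' zz' j; rewrite !Amul_coord//.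
by apply: NP => // i iN; rewrite zz'.
Qed.

(* Continue the digits of a point of [`]a, c[] periodically: by regularity the
   transforms converge to the periodic frequency. As the rows are summable,
   finitely many transforms depend, up to [e / 2], on finitely many digits. *)
Lemma generic_interval (nn : nat -> nat) (b k L m : nat) (u : nat -> nat)
    (e a c : R) :
  (forall i, (i <= nn i)%N) -> (1 < b)%N -> (0 < L)%N ->
  (forall i, (u i < b)%N) -> (forall i, u (L + i)%N = u i) -> 0 < e -> a < c ->
  exists a' c' : R, [/\ a' < c', forall x, a' < x < c' -> a < x < c &
    exists2 i, (m <= i)%N & forall x, a' < x < c' ->
      forall n, (nn i <= n < nn i.+1)%N -> forall j,
      `|Amul A (fun i => pivec b k x i.+1) n ord0 j
        - period_freq R b k u L ord0 j| < e].
Proof.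
move=> nn_ge b1 L0 ub uL e0 ac.
have acm : a < (a + c) / 2 < c by lra.
have [n0 [d [du cyl]]] := digit_cylinder b1 acm ub.
have [_ Aq] := A_regular (@seq_freq_cvg R b k _ _ _ _ L0 du uL).
set z := fun n => seq_freq R b k d n.+1 in Aq.
have e20 : 0 < e / 2 by rewrite divr_gt0.
have [N1 _ N1P] : \forall n \near \oo, forall j,
    `|period_freq R b k u L ord0 j - Amul A z n ord0 j| < e / 2.
  apply: filter_forall => j; move/cvg_rowP: Aq => /(_ j)/cvgrPdist_lt.
  exact.
pose i := maxn m N1.
have /choice[Nt NtP] := fun n => Amul_tail_small n e20.
pose N := \max_(n < nn i.+1) Nt n.
(* The frequencies up to index [N] read digits only up to [N + k]. *)
have [a' [c' [ac' sub_ac digE]]] := cyl (N + k)%N.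
exists a', c'; split=> //; exists i; first exact: leq_maxl.
move=> x xac n /andP[ni1 ni2] j.
have N1n : (N1 <= n)%N.
  by apply: leq_trans ni1; apply: leq_trans (nn_ge i); exact: leq_maxr.
have := N1P n N1n j.
have NnN : (Nt n <= N)%N.
  exact: (@leq_bigmax _ (fun n : 'I_(nn i.+1) => Nt n) (Ordinal ni2)).
have zE l : (l < Nt n)%N -> z l = pivec b k x l.+1.
  move=> lN; rewrite pivecE; apply: seq_freq_agree => l' l'l.
  by rewrite (digE x xac)//; apply: leq_trans l'l _; rewrite leq_add2r (leq_trans lN).
have z01 l j' : 0 <= z l ord0 j' <= 1 by exact: seq_freq_itv.
have p01 l j' : 0 <= pivec b k x l.+1 ord0 j' <= 1 by exact: seq_freq_itv.
have := NtP n _ z (fun l => pivec b k x l.+1) z01 p01 zE j.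
rewrite ltr_norml ler_norml ltr_norml; lra.
Qed.

End Genericity.

(** Coding by a finite list makes the periodic words countable. *)
Definition periodic_word (w : seq nat) (i : nat) : nat := nth 0%N w (i %% size w).

Lemma coord_val (R : realType) (b k : nat) (p : 'rV[R]_(dimS b k)) (t : str b k) :
  Defs.coord p t = p ord0 (enum_rank t).
Proof. by rewrite /Defs.coord valK. Qed.

Lemma Delta_approx_word (R : realType) (b k : nat) (eta : 'rV[R]_(dimS b k))
    (e : R) : (0 < k)%N -> Delta R b k eta -> 0 < e ->
  exists w : seq nat, [/\ (0 < size w)%N, all (fun l => l < b)%N w & forall j,
    `|eta ord0 j - period_freq R b k (periodic_word w) (size w) ord0 j| < e].
Proof.
case: k eta => // k eta _ [sum1 [ge0 bal]] e0.
pose p (s : str b k.+1) := eta ord0 (enum_rank s).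
have p0 s : 0 <= p s by exact: ge0.
have p1 : \sum_s p s = 1.
  by rewrite -sum1 (reindex (@enum_rank _))//; exact/onW_bij/enum_rank_bij.
have bal_p : balanced p.
  move=> s; have := bal s.
  rewrite (eq_bigr (fun c => p [tuple of c :: s])) => [->|c _]; last first.
    by rewrite /p -coord_val.
  by apply: eq_bigr => c _; rewrite /p -coord_val.
(* One quarter for approximating by a word, one for the windows across the end of its period. *)
have e40 : 0 < e / 4 by rewrite divr_gt0.
have [N0 N0P] := balanced_approximable p0 p1 bal_p e40.
pose N := maxn N0 (Num.truncn (k.+1%:R / (e / 4))).+1.
have [|u ub up] := N0P N; first exact: leq_maxl.
have N_gt0 : (0 < N)%N by rewrite leq_max orbT.
have kN : k.+1%:R <= N%:R * (e / 4).
  rewrite -ler_pdivrMr//; apply: ltW; apply: lt_le_trans (truncnS_gt _) _.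
  by rewrite ler_nat leq_maxr.
exists (mkseq u N); rewrite size_mkseq; split=> // [|j].
  by apply/allP => _ /mapP[i _ ->].
have wu i : (i < N)%N -> periodic_word (mkseq u N) i = u i.
  by move=> iN; rewrite /periodic_word size_mkseq modn_small// nth_mkseq.
have -> : eta ord0 j = p (enum_val j) by rewrite /p enum_valK.
rewrite mxE; set s : str b k.+1 := enum_val j.
have wc1 : (word_count s (periodic_word (mkseq u N)) N)%:R
    <= (word_count s u N)%:R + k.+1%:R :> R.
  by rewrite -natrD ler_nat word_count_agree.
have wc2 : (word_count s u N)%:R
    <= (word_count s (periodic_word (mkseq u N)) N)%:R + k.+1%:R :> R.
  by rewrite -natrD ler_nat word_count_agree// => i /wu.
have N0' : 0 < N%:R :> R by rewrite ltr0n.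
rewrite -[p s](mulfK (lt0r_neq0 N0')) -mulrBl normrM normfV (gtr0_norm N0').
rewrite ltr_pdivrMr// mulrC.
have Ne : 0 < N%:R * e by rewrite mulr_gt0.
have := up s; move: kN wc1 wc2; rewrite mulrA.
move: (word_count s _ N)%:R (word_count s u N)%:R (k.+1%:R) => x y z.
rewrite [e * _]mulrC ler_norml ltr_norml; lra.
Qed.

Lemma nowhere_dense_unit_itv (R : realType) (B : set R) :
  B `<=` `]0, 1] ->
  (forall a c : R, 0 <= a -> a < c -> c <= 1 -> exists a' c' : R,
     [/\ a' < c', forall x, a' < x < c' -> a < x < c &
       forall x, a' < x < c' -> ~ B x]) ->
  @nowhere_dense (subspace (`]0, 1]%classic : set R)) B.
Proof.
move=> BD gap; set D : set R := `]0, 1]%classic.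
apply/seteqP; split=> // x xB.
(* Points outside [D] are isolated in [subspace D], hence not in the closure of [B]. *)
have Dx : D x.
  apply: contrapT => nDx; have [|y [By yx]] := interior_subset xB [set x].
    by apply: open_nbhs_nbhs; split=> //; exact: open_subspace1out.
  by apply: nDx; rewrite -yx; exact: BD.
have {}xB : nbhs (x : subspace D) (closure (B : set (subspace D))) := xB.
have [V /nbhs_ballP[e /= e0 eV] BV] := (@nbhs_subspace_ex R D _ x Dx).1 xB.
have /andP[x0 x1] : 0 < x <= 1 by move: Dx; rewrite /D /= in_itv.
(* The gap is sought to the left of [x], which stays in [D] even when [x = 1]. *)
pose a := Num.max 0 (x - e).
have ax : a < x by rewrite gt_max x0 /= ltrBlDr ltrDl.
have [|a' [c' [ac' sub_ac noB]]] := gap a x _ ax x1; first by rewrite le_max lexx.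
pose y := (a' + c') / 2.
have yac : a' < y < c' by rewrite /y; lra.
have /andP[ay yx] := sub_ac _ yac.
move: ay; rewrite gt_max => /andP[y0 ye].
have Dy : D y by rewrite /D /= in_itv /= y0 (le_trans (ltW yx)).
have [] : (closure (B : set (subspace D)) `&` D) y.
  by rewrite BV; split=> //; apply: eV; rewrite /ball /= ger0_norm; lra.
move=> /(_ [set z | a' < z < c'])[] => [|z [Bz zac] _]; last exact: noB Bz.
apply/(@nbhs_subspace_ex R D _ y Dy); exists [set z | a' < z < c'] => //.
have := near_in_itvoo (x := y) (a := a') (b := c').
by rewrite in_itv /= => /(_ yac); apply: filterS => z; rewrite in_itv.
Qed.

Theorem theorem4p2 (R : realType) (I : set (set nat)) (A : nat -> nat -> R) :
  is_ideal I -> meager_ideal I -> regular_matrix A ->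
  comeager_in (`]0, 1]%classic : set R)
    [set x : R | forall b k : nat, (2 <= b)%N -> (1 <= k)%N ->
       @Delta R b k `<=` Gamma b k x I A].
Proof.
move=> idI meI regA; have [nn nn_ge nnP] := meager_ideal_intervals idI meI.
pose dist b k w x n j := `|Amul A (fun i => pivec b k x i.+1) n ord0 j
  - period_freq R b k (periodic_word w) (size w) ord0 j|.
pose good_word b w := [&& (1 < b)%N, (0 < size w)%N & all (fun l => l < b)%N w].
pose good_block b k m w x i := forall n, (nn i <= n < nn i.+1)%N ->
  forall j, dist b k w x n j < m.+1%:R^-1.
(* The index [m] is both the bound beyond which blocks count and the precision. The indices are
   countable, and [pickle] enumerates them. *)
pose Bad (t : nat * nat * nat * seq nat) : set R :=
  let: (b, k, m, w) := t in
  [set x | [/\ (`]0, 1]%classic : set R) x, good_word b w &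
    forall i, (m <= i)%N -> ~ good_block b k m w x i]].
exists (fun n => if unpickle n is Some t then Bad t else set0); split.
  move=> n; case: (unpickle n) => [[[[b k] m] w]|]; last first.
    by apply: nowhere_dense_unit_itv => [x []|a c _ ac _]; exists a, c; split=> // x _ [].
  apply: nowhere_dense_unit_itv => [x []//|a c _ ac _].
  have [/and3P[b1 w0 wb]|bad_w] := boolP (good_word b w); last first.
    by exists a, c; split=> // x _ [_ gw]; rewrite gw in bad_w.
  have pb i : (periodic_word w i < b)%N.
    by apply: (allP wb); rewrite mem_nth// ltn_pmod.
  have pL i : periodic_word w (size w + i) = periodic_word w i.
    by rewrite /periodic_word modnDl.
  have m0 : 0 < m.+1%:R^-1 :> R by rewrite invr_gt0.
  have [a' [c' [ac' sub_ac [i mi goodi]]]] :=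
    generic_interval regA k m nn_ge b1 w0 pb pL m0 ac.
  exists a', c'; split=> // x xac [_ _ /(_ i mi)]; apply.
  exact: goodi.
move=> x [Dx nSx]; apply: contrapT => noBad; apply: nSx => b k b1 k0 eta Deta.
move=> U oU Ueta.
have [e /= e0 eU] : exists2 e : R, 0 < e & ball eta e `<=` U.
  by apply/nbhs_ballP; exact: open_nbhs_nbhs.
have e20 : 0 < e / 2 by rewrite divr_gt0.
have [w [w0 wb wP]] := Delta_approx_word k0 Deta e20.
(* It remains to find, beyond any [M], a block on which all transforms lie in [U]. *)
apply: nnP => M.
pose m := maxn M (Num.truncn (e / 2)^-1).
have [i [mi goodi]] : exists i, (m <= i)%N /\ good_block b k m w x i.
  apply: contrapT => noi; apply: noBad; exists (pickle (b, k, m, w)) => //.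
  rewrite pickleK; split=> //; first exact/and3P.
  by move=> i mi goodi; apply: noi; exists i.
exists i => [|n ni]; first exact: leq_trans (leq_maxl _ _) mi.
have me : m.+1%:R^-1 < e / 2.
  rewrite -[ltRHS]invrK ltf_pV2 ?posrE ?invr_gt0//.
  apply: lt_le_trans (truncnS_gt _) _.
  by rewrite ler_nat ltnS leq_maxr.
apply: eU; split=> // i' j; rewrite ord1.
suff : `|eta ord0 j - Amul A (fun i => pivec b k x i.+1) n ord0 j| < e by [].
move: (wP j) (goodi n ni j) me; rewrite /dist !ltr_norml.
move: (Amul _ _ _ _ _) (period_freq _ _ _ _ _ _ _) (eta _ _) m.+1%:R^-1.
by move=> v q y r; lra.
Qed.
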